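(* Suppose $\theta=\mathbf{b}/\mathbf{a}$ is a Roth number. For all $\varepsilon>0$, for every $\eta\in\,\big]0,\frac{(\sqrt2)^{1+\varepsilon}}{2}\big[$ small enough that $t_\eta(\varepsilon)\geq\max_i|T_{cl_i}|$, and for all integers $k\geq1$, there exists a constant $D_k>0$ which does not depend on $h$ such that (for all sufficiently small $h$) the inequality $$|\mathbf{a_1}(t)|\leq D_k\,h^{k(1-\max(\delta_1',\delta_2'))}\,\eta^{-k}$$ holds for all $t\in[\max_i|T_{cl_i}|,\,t_\eta(\varepsilon)]$.
   Context: Setting. Fix $\omega_1,\omega_2>0$, a polynomial $F\in\mathbb{R}[X,Y]$ not depending on $h$, a point $(E_1,E_2)\in\,]0,1]^2$, exponents $\delta_1',\delta_2'\in\,]0,1[$ and a nonnegative, not identically zero function $\chi\in\mathcal{S}(\mathbb{R}^2)$. $h>0$ is a small parameter. For integers $n,m$ put $\tau_n:=\omega_1h(n+\tfrac12)$, $\mu_m:=\omega_2h(m+\tfrac12)$. Let $n_0=n_0(h)$ (resp. $m_0=m_0(h)$) be the integer in $\mathbb{N}=\{0,1,2,\dots\}$ minimizing $|\tau_n-E_1|$ (resp. $|\mu_m-E_2|$), assumed unique. For $(n,m)\in\mathbb{Z}^2$ put $$a_{n,m}:=K_h\,\chi\Big(\frac{\tau_n-\tau_{n_0}}{h^{\delta_1'}},\frac{\mu_m-\mu_{m_0}}{h^{\delta_2'}}\Big),\qquad K_h:=\Big\|\chi\Big(\frac{\tau_n-\tau_{n_0}}{h^{\delta_1'}},\frac{\mu_m-\mu_{m_0}}{h^{\delta_2'}}\Big)\Big\|_{\ell^2(\mathbb{N}^2)}^{-1},$$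 so that $\sum_{n,m\in\mathbb{N}}|a_{n,m}|^2=1$ ($h$ small enough). Assume $\frac{\partial F}{\partial X}(E_1,E_2)\neq0$ and $\frac{\partial F}{\partial Y}(E_1,E_2)\neq0$. Put $T_{cl_1}:=\frac{2\pi}{\omega_1\frac{\partial F}{\partial X}(E_1,E_2)}$, $T_{cl_2}:=\frac{2\pi}{\omega_2\frac{\partial F}{\partial Y}(E_1,E_2)}$ and $$\mathbf{a_1}(t):=\sum_{(n,m)\in\mathbb{N}^2}|a_{n,m}|^2e^{-2i\pi t\left(\frac{n-n_0}{T_{cl_1}}+\frac{m-m_0}{T_{cl_2}}\right)}.$$ Put $\mathbf{a}:=1/|T_{cl_1}|$, $\mathbf{b}:=1/|T_{cl_2}|$, $\varphi_t:=(\mathbf{a}t,\mathbf{b}t)\in\mathbb{R}^2$, $\mathbb{Z}^2_*:=\mathbb{Z}^2\setminus\{(0,0)\}$. An irrational $\theta$ is a Roth number if for every $\varepsilon>0$ there is $C_\varepsilon>0$ with $|\theta-\frac pq|\geq\frac{C_\varepsilon}{q^{2+\varepsilon}}$ for all $(p,q)\in\mathbb{Z}\times\mathbb{N}^*$. For $\theta=\mathbf{b}/\mathbf{a}$ Roth and each $\varepsilon>0$, $K_\varepsilon\in\,]0,C_\varepsilon]$ denotes a fixed constant such that the Euclidean distance satisfies $d(\varphi_t,\mathbb{Z}^2_* )\geq K_\varepsilon\big(\frac{\sqrt2}{2}+t\sqrt{\mathbf{a}^2+\mathbf{b}^2}\big)^{-(1+\varepsilon)}$ for all $t\geq0$ (such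 a constant exists). For $\varepsilon,\eta>0$, $$t_\eta(\varepsilon):=\frac{1}{\sqrt{\mathbf{a}^2+\mathbf{b}^2}}\Big(\Big(\frac{K_\varepsilon}{\eta}\Big)^{\frac1{1+\varepsilon}}-\frac{\sqrt2}{2}\Big).$$ *)

(* Defs.v *)
From HB Require Import structures.
From mathcomp Require Import all_boot all_order all_algebra polyXY.
From mathcomp Require Import complex.
From mathcomp Require Import all_classical all_reals all_analysis.
From mathcomp Require summability.

Set Implicit Arguments.
Unset Strict Implicit.
Unset Printing Implicit Defensive.

Import Order.TTheory GRing.Theory Num.Theory.
Import numFieldNormedType.Exports.

Local Open Scope classical_set_scope.
Local Open Scope ring_scope.

(* Polynomials of R[X,Y] follow the convention of polyXY: the outer variable
   of {poly {poly R}} is X, the inner one is Y, and F.[x, y] = F(x, y). *)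
Definition dX (R : realType) (F : {poly {poly R}}) : {poly {poly R}} := deriv F.

Definition dY (R : realType) (F : {poly {poly R}}) : {poly {poly R}} :=
  map_poly (@deriv R) F.

(* Partial derivative in the first (d = false) or second (d = true) variable. *)
Definition pderiv (R : realType) (d : bool) (f : R * R -> R) : R * R -> R :=
  fun z => 'D_(if d then (0, 1) else (1, 0)) f z.

(* Every partial derivative, of any order and in any order of the variables,
   is (Frechet) differentiable everywhere. *)
Definition smooth2 (R : realType) (f : R * R -> R) : Prop :=
  forall (w : seq bool) (z : R * R), differentiable (foldr (@pderiv R) f w) z.

Definition schwartz2 (R : realType) (f : R * R -> R) : Prop :=
  smooth2 f /\
  forall i j k l : nat, exists M : R, forall z : R * R,
    `| z.1 ^+ i * z.2 ^+ j
       * iter k (pderiv false) (iter l (pderiv true) f) z | <= M.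

(* tau_n for omega = omega_1 and mu_m for omega = omega_2. *)
Definition level (R : realType) (omega h : R) (n : int) : R :=
  omega * h * (n%:~R + 2^-1).

Definition unique_nearest_level (R : realType) (omega h E : R) (n0 : nat) :
    Prop :=
  forall n : nat, n != n0 ->
    `| level omega h n0%:Z - E | < `| level omega h n%:Z - E |.

Definition unnormalized_coef (R : realType) (omega1 omega2 delta1 delta2 : R)
    (chi : R * R -> R) (h : R) (n0 m0 : nat) (n m : int) : R :=
  chi ((level omega1 h n - level omega1 h n0%:Z) / h `^ delta1,
       (level omega2 h m - level omega2 h m0%:Z) / h `^ delta2).

(* summability.sum is the unconditional sum of a family: the limit of its
   finite partial sums along the finite subsets ordered by inclusion. *)
Definition l2norm (R : realType) (u : nat * nat -> R) : R :=
  Num.sqrt (summability.sum (fun p : nat * nat => `| u p | ^+ 2 : R^o)).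

Definition coef (R : realType) (omega1 omega2 delta1 delta2 : R)
    (chi : R * R -> R) (h : R) (n0 m0 : nat) (n m : int) : R :=
  let u := unnormalized_coef omega1 omega2 delta1 delta2 chi h n0 m0 in
  (l2norm (fun p : nat * nat => u p.1%:Z p.2%:Z))^-1 * u n m.

Definition Tcl (R : realType) (omega dF : R) : R := 2 * pi / (omega * dF).

Definition expi (R : realType) (x : R) : R[i] := Complex (cos x) (sin x).

Definition autocorr1 (R : realType) (omega1 omega2 delta1 delta2 : R)
    (chi : R * R -> R) (T1 T2 h : R) (n0 m0 : nat) (t : R) : R[i] :=
  summability.sum (fun p : nat * nat =>
    (`| coef omega1 omega2 delta1 delta2 chi h n0 m0 p.1%:Z p.2%:Z | ^+ 2)%:C%C
    * expi (- (2 * pi * t * ((p.1%:R - n0%:R) / T1 + (p.2%:R - m0%:R) / T2)))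
    : R[i]^o).

Definition roth_constant (R : realType) (theta eps C : R) : Prop :=
  0 < C /\
  forall (p : int) (q : nat), (0 < q)%N ->
    C / q%:R `^ (2 + eps) <= `| theta - p%:~R / q%:R |.

Definition roth_number (R : realType) (theta : R) : Prop :=
  irrational theta /\
  forall eps : R, 0 < eps -> exists C : R, roth_constant theta eps C.

Definition dist_lattice (R : realType) (x y : R) : R :=
  inf [set Num.sqrt ((x - p.1%:~R) ^+ 2 + (y - p.2%:~R) ^+ 2)
      | p in [set p : int * int | p != (0, 0)]].

Definition t_eta (R : realType) (a b K eta eps : R) : R :=
  (Num.sqrt (a ^+ 2 + b ^+ 2))^-1
  * ((K / eta) `^ (1 + eps)^-1 - Num.sqrt 2 / 2).

(* Main.v *)
Require Import Defs.
From HB Require Import structures.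
From mathcomp Require Import all_boot all_order all_algebra polyXY.
From mathcomp Require Import complex.
From mathcomp Require Import all_classical all_reals all_analysis.
From mathcomp Require Import finmap ring lra.
Import Order.TTheory GRing.Theory Num.Theory.
Import numFieldNormedType.Exports.

Local Open Scope ring_scope.

(* For t in the given range, the lattice point nearest to phi_t has coordinates
   >= 1, so K_eps bounds its distance to phi_t from below by eta, and one of
   t / T1, t / T2 stays at distance >= eta / 2 from the integers.  In that
   direction the geometric ratio z of the sum is bounded away from 1, and k
   summations by parts turn (1 - z)^k * sum into a sum of k-th backward
   differences of chi^2 sampled with step s = omega h^(1 - delta), each of size
   s^k, plus boundary terms that are negligible by Schwartz decay because both
   ends of the range lie at distance >= (E / 2) h^(-delta) from the centre.
   Summing against the weights 1 / (1 + x^2) costs 1 / (s1 s2), which the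
   normalization K_h^2 <= C s1 s2 compensates. *)

(** * Summation by parts with backward differences *)

Definition bdiff {U V : zmodType} (s : U) (f : U -> V) (x : U) : V :=
  f x - f (x - s).

(** The backward difference at index 0 reaches [F (x - s)], so the left boundary term sits one step
    outside the range of summation. *)
Lemma summation_by_parts {R C : numDomainType} (s x : R) (F : R -> C) (z : C)
    (N : nat) :
  (1 - z) * \sum_(i < N) F (x + s * i%:R) * z ^+ i =
  F (x - s) - F (x + s * N%:R - s) * z ^+ N
  + \sum_(i < N) bdiff s F (x + s * i%:R) * z ^+ i.
Proof.
elim: N => [|N IH]; first by rewrite !big_ord0 !mulr0 !addr0 expr0 mulr1 subrr.
rewrite !big_ord_recr /= mulrDr IH /bdiff.
have -> : x + s * N.+1%:R - s = x + s * N%:R by rewrite -natr1; ring.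
by rewrite exprS; ring.
Qed.

(** Each summation by parts leaves two boundary values, at most [2 * b] together. They get
    multiplied by remaining powers of [|1 - z| <= 2], and the total stays below
    [2 ^+ k * (2 * b)]. *)
Lemma norm_sum_by_parts {R C : numDomainType} (s x : R) (F : R -> C) (z b : C)
    (N k : nat) : `|z| = 1 -> 0 <= b ->
  (forall j, (j < k)%N -> `|iter j (bdiff s) F (x - s)| <= b) ->
  (forall j, (j < k)%N -> `|iter j (bdiff s) F (x + s * N%:R - s)| <= b) ->
  `|1 - z| ^+ k * `|\sum_(i < N) F (x + s * i%:R) * z ^+ i| <=
  2 ^+ k * (2 * b) + \sum_(i < N) `|iter k (bdiff s) F (x + s * i%:R)|.
Proof.
move=> z1 b0; elim: k F => [|k IH] F Fl Fr.
  rewrite !expr0 !mul1r -[leLHS]add0r lerD ?mulr_ge0//.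
  apply: le_trans (ler_norm_sum _ _ _) _; apply: ler_sum => i _.
  by rewrite normrM normrX z1 expr1n mulr1.
have z2 : `|1 - z| <= 2.
  by apply: le_trans (ler_normB _ _) _; rewrite z1 normr1.
have zk : `|1 - z| ^+ k <= 2 ^+ k by rewrite lerXn2r ?nnegrE.
rewrite exprSr -mulrA -normrM summation_by_parts.
have Fb : `|F (x - s) - F (x + s * N%:R - s) * z ^+ N| <= 2 * b.
  apply: le_trans (ler_normB _ _) _.
  rewrite normrM normrX z1 expr1n mulr1 mulr_natl mulr2n.
  by rewrite lerD// ?(Fl 0%N)// (Fr 0%N).
apply: (@le_trans _ _ (2 ^+ k * (2 * b)
    + `|1 - z| ^+ k * `|\sum_(i < N) bdiff s F (x + s * i%:R) * z ^+ i|)).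
  apply: (@le_trans _ _ (`|1 - z| ^+ k * (2 * b
    + `|\sum_(i < N) bdiff s F (x + s * i%:R) * z ^+ i|))).
    rewrite ler_wpM2l ?exprn_ge0//; apply: le_trans (ler_normD _ _) _.
    by rewrite lerD2r.
  by rewrite mulrDr lerD2r ler_wpM2r ?mulr_ge0.

under [X in _ <= _ + X]eq_bigr do rewrite iterSr.
have -> : 2 ^+ k.+1 * (2 * b) = 2 ^+ k * (2 * b) + 2 ^+ k * (2 * b).
  by rewrite exprS -mulrA mulr_natl mulr2n.
rewrite -addrA lerD2l; apply: IH => j jk; rewrite -iterSr.
- exact: Fl.
- exact: Fr.
Qed.

(** * Product rule and mean value bound for iterated backward differences *)

Section backward_differences.
Context {R : realType}.
Implicit Types (f g : R -> R) (s x A B : R).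

Lemma iter_bdiffD s f g i :
  iter i (bdiff s) (f \+ g) = iter i (bdiff s) f \+ iter i (bdiff s) g.
Proof.
elim: i => // i IH; rewrite !iterS IH; apply/funext => x /=.
by rewrite /bdiff /=; ring.
Qed.

Lemma iter_bdiff_shift s f i x :
  iter i (bdiff s) (fun y => f (y - s)) x = iter i (bdiff s) f (x - s).
Proof. by elim: i x => // i IH x; rewrite !iterS /bdiff !IH. Qed.

(** Discrete Leibniz rule: each difference of a product gives two products, hence the factor
    [2 ^+ k]. One of them shifts [g] by [s], which is why the hypotheses are needed at the points
    [x - s * j]. *)
Lemma norm_iter_bdiffM s A B f g k x : 0 <= s ->
  (forall i j, (i + j <= k)%N ->
     `|iter i (bdiff s) f (x - s * j%:R)| <= s ^+ i * A) ->
  (forall i j, (i + j <= k)%N ->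
     `|iter i (bdiff s) g (x - s * j%:R)| <= s ^+ i * B) ->
  `|iter k (bdiff s) (f \* g) x| <= (2 * s) ^+ k * (A * B).
Proof.
move=> s0; elim: k f g A B => [|k IH] f g A B Hf Hg.
  have := Hf 0%N 0%N isT; have := Hg 0%N 0%N isT.
  by rewrite /= !mulr0 !subr0 !expr0 !mul1r normrM => *; rewrite ler_pM.
have -> : iter k.+1 (bdiff s) (f \* g) =
    iter k (bdiff s) (f \* bdiff s g \+ bdiff s f \* (fun y => g (y - s))).
  by rewrite iterSr; congr iter; apply/funext => y; rewrite /bdiff /=; ring.
rewrite iter_bdiffD /=; apply: le_trans (ler_normD _ _) _.
have -> : (2 * s) ^+ k.+1 * (A * B) =
  (2 * s) ^+ k * (A * (s * B)) + (2 * s) ^+ k * ((s * A) * B).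
  by rewrite exprS; ring.
apply: lerD; apply: IH => i j ij.
- by apply: Hf; rewrite (leq_trans ij).
- by rewrite -iterSr mulrA -exprSr Hg.
- by rewrite -iterSr mulrA -exprSr Hf.
- rewrite iter_bdiff_shift.
  have -> : x - s * j%:R - s = x - s * j.+1%:R by rewrite -natr1; ring.
  by apply: Hg; rewrite addnS.
Qed.

Lemma is_derive_iter_bdiff s (D : nat -> R -> R) :
  (forall l x, is_derive x 1 (D l) (D l.+1 x)) ->
  forall i l x, is_derive x (1 : R) (iter i (bdiff s) (D l))
                                 (iter i (bdiff s) (D l.+1) x).
Proof.
move=> dD; elim=> [|i IH] l x //=.
apply: is_deriveB.
rewrite -[iter i (bdiff s) (D l.+1) (x - s)]mulr1.
apply: (@is_derive1_comp _ (iter i (bdiff s) (D l)) (shift (- s))).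
exact: is_derive_shift.
Qed.

(** The mean value theorem trades each difference for a factor [s] and one more derivative, at a
    point at most [s] further left. After [i] trades the point lies in [[x - s * i, x]]. *)
Lemma norm_iter_bdiff_le s M (D : nat -> R -> R) : 0 <= s ->
  (forall l x, is_derive x 1 (D l) (D l.+1 x)) ->
  forall i l x,
  (forall u, x - s * i%:R <= u <= x -> `|D (l + i)%N u| <= M) ->
  `|iter i (bdiff s) (D l) x| <= s ^+ i * M.
Proof.
move=> s0 dD; elim=> [|i IH] l x HM.
  by rewrite expr0 mul1r; have := HM x; rewrite mulr0 subr0 addn0 lexx; apply.
have dI := @is_derive_iter_bdiff s D dD i.
have fc : {within `[x - s, x], continuous (iter i (bdiff s) (D l))}%classic.
  apply: continuous_subspaceT => y.
  by apply: differentiable_continuous; apply/derivable1_diffP; exact: ex_derive.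
have xs : x - s <= x by lra.
have [c + fE] := MVT_segment xs (fun y _ => dI l y) fc.
rewrite iterS [bdiff s _ x]fE.
rewrite in_itv /= => /andP[c1 c2].
have -> : x - (x - s) = s by ring.
rewrite normrM (ger0_norm s0) mulrC exprS -mulrA ler_wpM2l//.
apply: IH => u /andP[u1 u2]; rewrite addSnnS; apply: HM.
by rewrite -natr1; apply/andP; split; lra.
Qed.

End backward_differences.

(** * Backward differences of rapidly decaying functions *)

Section decay.
Context {R : realType}.
Implicit Types (x y s : R).

(** [D l] stands for the [l]-th derivative in the first variable, the second being a parameter, so
    that one estimate serves both directions of [chi]. Arbitrary powers in [x] make boundary terms
    negligible; the fixed weight in [y] makes the sum in the other direction converge. *)
Definition decaying_derivatives (D : nat -> R -> R -> R) : Prop :=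
  (forall l x y, is_derive x 1 (fun u => D l u y) (D l.+1 x y)) /\
  (forall l p, exists M, forall x y,
     (1 + x ^+ 2) ^+ p * (1 + y ^+ 2) * `|D l x y| <= M).

Lemma decaying_derivatives_bound D p k : decaying_derivatives D ->
  exists2 M, 0 < M & forall l x y, (l <= k)%N ->
     `|D l x y| <= M / ((1 + x ^+ 2) ^+ p * (1 + y ^+ 2)).
Proof.
move=> [_ Db]; elim: k => [|k [M M0 HM]].
  have [M HM] := Db 0%N p.
  exists (`|M| + 1) => [|l x y]; first by rewrite ltr_wpDl.
  rewrite leqn0 => /eqP ->.
  have w0 : 0 < (1 + x ^+ 2) ^+ p * (1 + y ^+ 2).
    by rewrite mulr_gt0 ?exprn_gt0 ?ltr_pwDl ?sqr_ge0.
  rewrite ler_pdivlMr// mulrC (le_trans (HM _ _))// (le_trans (ler_norm _))//.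
  by rewrite lerDl.
have [M' HM'] := Db k.+1 p.
exists (`|M'| + M) => [|l x y]; first by rewrite ltr_wpDl.
have w0 : 0 < (1 + x ^+ 2) ^+ p * (1 + y ^+ 2).
  by rewrite mulr_gt0 ?exprn_gt0 ?ltr_pwDl ?sqr_ge0.
rewrite leq_eqVlt ltnS => /predU1P[->|/HM le_l]; last first.
  by rewrite (le_trans (le_l _ _))// ler_wpM2r ?invr_ge0 ?(ltW w0)// lerDr.
rewrite ler_pdivlMr// mulrC (le_trans (HM' _ _))// (le_trans (ler_norm _))//.
by rewrite lerDl ltW.
Qed.

(** Follows from [x^2 <= 2 u^2 + 2 (x - u)^2]. It carries the decay weight from the intermediate
    points of the mean value theorem back to [x]. *)
Lemma bracket_window (k : nat) x u : x - k%:R <= u <= x ->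
  1 + x ^+ 2 <= (2 + 2 * k%:R ^+ 2) * (1 + u ^+ 2).
Proof.
move=> /andP[u1 u2].
have k0 : 0 <= k%:R :> R by [].
have : (x - u) ^+ 2 <= k%:R ^+ 2 by rewrite lerXn2r ?nnegrE; lra.
have := sqr_ge0 (x - 2 * u).
have := mulr_ge0 (sqr_ge0 (k%:R : R)) (sqr_ge0 u).
nra.
Qed.

Lemma norm_iter_bdiff_sqr D (k p : nat) : decaying_derivatives D ->
  exists2 M, 0 < M & forall s j x y, 0 <= s <= 1 -> (j <= k)%N ->
    `|iter j (bdiff s) (fun u => D 0%N u y ^+ 2) x| <=
    s ^+ j * (M / ((1 + x ^+ 2) ^+ p * (1 + y ^+ 2))).
Proof.
move=> Ddec; have [M M0 HM] := decaying_derivatives_bound D p k Ddec.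
pose c : R := 2 + 2 * k%:R ^+ 2.
have k0 : 0 <= k%:R :> R by [].
have c1 : 1 <= c by rewrite /c; have := sqr_ge0 (k%:R : R); lra.
have c0 : 0 < c by lra.
(* The factor [c ^+ p] pays for moving the weight from a point of the window to [x]. *)
pose M' := c ^+ p * M.
have M'0 : 0 < M' by rewrite mulr_gt0 ?exprn_gt0.
(* [2 ^+ k] comes from the Leibniz rule and one [M'] from each factor of the square. Both factors
   decay like [1 / w]; since [w >= 1], only one is kept. *)
exists (2 ^+ k * (M' * M')) => [|s j x y /andP[s0 s1] jk].
  by rewrite !mulr_gt0 ?exprn_gt0.
set w := (1 + x ^+ 2) ^+ p * (1 + y ^+ 2).
have w1 : 1 <= w.
  by rewrite -[leLHS]mulr1 ler_pM ?exprn_ege1 ?lerDl ?sqr_ge0.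
have w0 : 0 < w by lra.
have Hi i l : (i + l <= j)%N ->
    `|iter i (bdiff s) (fun u => D 0%N u y) (x - s * l%:R)| <= s ^+ i * (M' / w).
  move=> il.
  have dD := fun l x => Ddec.1 l x y.
  apply: (@norm_iter_bdiff_le _ s _ (fun l u => D l u y) s0 dD i 0%N).
  move=> u /andP[u1 u2]; rewrite add0n.
  have ij : (i <= k)%N by rewrite (leq_trans (leq_addr l i))// (leq_trans il).
  apply: le_trans (HM _ _ _ ij) _.
  have uw : 1 + x ^+ 2 <= c * (1 + u ^+ 2).
    apply: bracket_window.
    have : (i + l)%:R <= k%:R :> R by rewrite ler_nat (leq_trans il).
    rewrite natrD.
    have : s * i%:R <= i%:R by rewrite ler_piMl.
    have : s * l%:R <= l%:R by rewrite ler_piMl.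
    have : 0 <= s * l%:R by rewrite mulr_ge0.
    by move=> *; apply/andP; split; lra.
  rewrite /M' [c ^+ p * M]mulrC -mulrA ler_pM2l//.
  have u0 : 0 < 1 + u ^+ 2 by rewrite ltr_pwDl ?sqr_ge0.
  have y0 : 0 < 1 + y ^+ 2 by rewrite ltr_pwDl ?sqr_ge0.
  have v0 : 0 < (1 + u ^+ 2) ^+ p * (1 + y ^+ 2) by rewrite mulr_gt0 ?exprn_gt0.
  rewrite ler_pdivlMr// mulrC ler_pdivrMr// /w mulrA ler_pM2r// -exprMn.
  by rewrite lerXn2r ?nnegrE ?mulr_ge0 ?(ltW u0) ?(ltW c0)// addr_ge0 ?sqr_ge0.
rewrite (_ : (fun u => _) = (fun u => D 0%N u y) \* (fun u => D 0%N u y)); last first.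
  by apply/funext => u; rewrite /= expr2.
apply: le_trans (@norm_iter_bdiffM _ s (M' / w) (M' / w) _ _ j x s0 Hi Hi) _.
rewrite [leLHS](_ : _ = s ^+ j * (M' / w * (M' / w * 2 ^+ j))); last first.
  by rewrite exprMn; move: (2 ^+ j) (s ^+ j) => c2 c3; ring.
rewrite ler_wpM2l ?exprn_ge0//.
rewrite [leRHS](_ : _ = M' / w * (M' * 2 ^+ k)); last first.
  by move: (2 ^+ k) => c2; ring.
rewrite ler_wpM2l ?divr_ge0 ?(ltW w0) ?(ltW M'0)//.
rewrite ler_pM ?divr_ge0 ?(ltW w0) ?(ltW M'0) ?exprn_ge0//.
  by rewrite ler_pdivrMr// ler_peMr// ltW.
by rewrite ler_weXn2l// ler1n.
Qed.

(** [x / (1 + |x|)] is a bounded increasing substitute for the arctangent, with derivative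
    [1 / (1 + |x|)^2] comparable to [1 / (1 + x^2)]. *)
Lemma telescope_bracket s x : 0 < s <= 1 ->
  s / (1 + x ^+ 2) <= 4 * (x / (1 + `|x|) - (x - s) / (1 + `|x - s|)).
Proof.
move=> /andP[s0 s1].
have x0 : 0 < 1 + x ^+ 2 by rewrite ltr_pwDl ?sqr_ge0.
have n0 : 0 < 1 + `|x| by rewrite ltr_pwDl.
have n1 : 0 < 1 + `|x - s| by rewrite ltr_pwDl.
rewrite (_ : 4 * _ = 4 * (x * (1 + `|x - s|) - (x - s) * (1 + `|x|))
    / ((1 + `|x|) * (1 + `|x - s|))); last first.
  by field; rewrite !gt_eqF.
rewrite ler_pdivrMr// mulrAC ler_pdivlMr ?mulr_gt0//.
(* With the difference written as a single fraction [P / Q], it remains to check [s <= P] and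
   [Q <= 4 * (1 + x ^+ 2)] for each choice of signs of [x] and [x - s]. *)
have scale P Q : s <= P -> Q <= 4 * (1 + x ^+ 2) ->
    s * Q <= 4 * P * (1 + x ^+ 2).
  move=> sP Q4; apply: le_trans (ler_wpM2l (ltW s0) Q4) _.
  by rewrite mulrCA mulrA ler_pM2r// ler_pM2l.
have sx : x < 0 -> x - s < 0 by lra.
case: (leP 0 x) => hx.
  rewrite (ger0_norm hx); case: (leP 0 (x - s)) => hxs; apply: scale.
  - by rewrite ger0_norm//; lra.
  - rewrite ger0_norm//.
    by have := mulr_ge0 hx (ltW s0); have := sqr_ge0 (x - 1); nra.
  - rewrite ltr0_norm//.
    by have : 0 <= x * (s - x) by [rewrite mulr_ge0//; lra]; nra.
  - rewrite ltr0_norm//.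
    have : (1 + x) * (1 - (x - s)) <= 2 * 2 by rewrite ler_pM//; lra.
    by have := sqr_ge0 x; lra.
rewrite (ltr0_norm hx) (ltr0_norm (sx hx)); apply: scale; first by nra.
by have := sqr_ge0 (x + 1); nra.
Qed.

(** The sum telescopes to [4 / s] times a difference of two values in [[-1, 1]], so the bound is
    uniform in [x] and [N]. *)
Lemma sum_bracket_le s x N : 0 < s <= 1 ->
  \sum_(i < N) (1 + (x + s * i%:R) ^+ 2)^-1 <= 8 / s.
Proof.
move=> s01; have /andP[s0 s1] := s01.
pose G (u : R) := u / (1 + `|u|).
have G1 u : -1 <= G u <= 1.
  have u0 : 0 < 1 + `|u| by rewrite ltr_pwDl.
  rewrite -ler_norml normrM normfV (gtr0_norm u0) ler_pdivrMr// mul1r.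
  by rewrite lerDr.
have : s * \sum_(i < N) (1 + (x + s * i%:R) ^+ 2)^-1 <=
       4 * (G (x + s * N%:R - s) - G (x - s)).
  elim: N => [|N IH]; first by rewrite big_ord0 !mulr0 addr0 subrr mulr0.
  rewrite big_ord_recr /= mulrDr.
  have -> : x + s * N.+1%:R - s = x + s * N%:R by rewrite -natr1; ring.
  by have := telescope_bracket s (x + s * N%:R) s01; rewrite -/(G _) -/(G _); lra.
have := G1 (x - s); have := G1 (x + s * N%:R - s).
by move=> /andP[_ ?] /andP[? _] H; rewrite ler_pdivlMr// mulrC; lra.
Qed.

End decay.

(** * The one-dimensional oscillating sum *)

Lemma norm_real_complex {R : realType} (r : R) : `|r%:C%C| = `|r|%:C%C.
Proof. by rewrite normc_def /= expr0n addr0 sqrtr_sqr. Qed.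

Lemma iter_bdiff_real_complex {R : realType} (s : R) (f : R -> R) j x :
  iter j (bdiff s) (fun u => (f u)%:C%C) x = (iter j (bdiff s) f x)%:C%C.
Proof. by elim: j x => // j IH x; rewrite !iterS /bdiff !IH rmorphB. Qed.

Lemma powR_small {R : realType} (e c : R) : 0 < e -> 0 < c ->
  exists2 h0, 0 < h0 & forall h, 0 < h < h0 -> h `^ e <= c.
Proof.
move=> e0 c0; exists (c `^ e^-1) => [|h /andP[h0 hc]]; first exact: powR_gt0.
rewrite -[leRHS]powRr1 ?(ltW c0)// -(mulVf (lt0r_neq0 e0)) powRrM.
by rewrite ge0_ler_powR ?nnegrE ?powR_ge0 ?ltW.
Qed.

(** Levels are midpoints of the cells [[g n, g (n + 1)[], so the cell containing [E] has its level
    within [g / 2] of [E], and the nearest level is at least as close. *)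
Lemma nearest_level_bounds {R : realType} (omega h E : R) (n0 : nat) :
  0 < omega * h -> 0 <= E -> unique_nearest_level omega h E n0 ->
  E - omega * h <= omega * h * n0%:R <= E.
Proof.
set g := omega * h => g0 E0 near0.
suff : `|level omega h n0%:Z - E| <= g / 2.
  rewrite /level -/g ler_norml => /andP[]; rewrite -pmulrn => *.
  by apply/andP; split; lra.
pose n := Num.truncn (E / g).
have /andP[n1 n2] : n%:R <= E / g < n.+1%:R.
  by apply: truncn_itv; rewrite divr_ge0// ltW.
have nE : `|level omega h n%:Z - E| <= g / 2.
  move: n1 n2; rewrite ler_pdivlMr// ltr_pdivrMr// -natr1 => n1 n2.
  by rewrite /level -/g ler_norml -pmulrn; apply/andP; split; lra.
by have [<-//|/near0/ltW] := eqVneq n n0; move=> /le_trans; apply.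
Qed.

(** The right side is [omega h n0 / h^delta], and [omega h n0 >= E - omega h >= E / 2] for such [h].
    Thus index 0 is far from the centre on the rescaled lattice. *)
Lemma scaled_nearest_level_ge {R : realType} (omega delta h E : R) (n0 : nat) :
  0 < omega -> 0 < E -> 0 < h < E / 2 / omega ->
  unique_nearest_level omega h E n0 ->
  E / 2 / h `^ delta <= omega * h `^ (1 - delta) * n0%:R.
Proof.
move=> omega0 E0 /andP[h0 hE] near0.
have /andP[lE _] : E - omega * h <= omega * h * n0%:R <= E.
  by apply: nearest_level_bounds near0; rewrite ?mulr_gt0// ltW.
have hd : 0 < h `^ delta by rewrite powR_gt0.
move: hE; rewrite ltr_pdivlMr// => hE.
rewrite ler_pdivrMr// powRB ?(gt_eqF h0) ?implybT// powRr1 ?(ltW h0)//.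
rewrite [leRHS](_ : _ = omega * h * n0%:R); first lra.
by field; rewrite gt_eqF.
Qed.

Section one_dimensional_estimate.
Context {R : realType}.

Lemma oscillating_sum_le (D : nat -> R -> R -> R) (k : nat)
    (omega delta E : R) :
  decaying_derivatives D -> 0 < omega -> 0 < E -> 0 < delta < 1 ->
  exists2 C : R, 0 < C & exists2 h0 : R, 0 < h0 &
  forall h, 0 < h < h0 ->
  forall n0, unique_nearest_level omega h E n0 ->
  forall N, (2 * n0 < N)%N -> forall (y : R) (z : R[i]), `|z| = 1 ->
  forall s, s = omega * h `^ (1 - delta) ->
  `|1 - z| ^+ k *
  `|\sum_(i < N) (D 0%N (- (s * n0%:R) + s * i%:R) y ^+ 2)%:C%C * z ^+ i|
  <= (C * h `^ (k%:R * (1 - delta)) / s / (1 + y ^+ 2))%:C%C.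
Proof.
move=> Ddec omega0 E0 /andP[delta0 delta1].
(* At distance at least [(E / 2) h^(-delta)] the weight of order [p] yields [h^(2 p delta)], which
   this choice puts below [h^(k (1 - delta))]. Positivity of [p] keeps a summable weight in the
   interior. *)
have [p p0 pk] : exists2 p : nat, (0 < p)%N & k%:R <= p%:R * delta.
  exists (Num.truncn (k%:R / delta)).+1 => //.
  by rewrite -ler_pdivrMr// ltW// truncnS_gt.
have [M M0 HM] := norm_iter_bdiff_sqr D k p Ddec.
(* The first term bounds the interior sum of [k]-th differences, where [s ^+ k] supplies the power
   of [h] and the weights sum to [8 / s]. The second bounds the boundary terms. *)
pose C := 8 * omega ^+ k * M + 2 ^+ k * (2 * (M * ((2 / E) ^+ 2) ^+ p)).
have C0 : 0 < C.
  by rewrite addr_gt0// !mulr_gt0 ?exprn_gt0// divr_gt0.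
have e0 : 0 < 1 - delta by lra.
have [h1 h10 Hh1] : exists2 h1, 0 < h1 &
    forall h : R, 0 < h < h1 -> h `^ (1 - delta) <= omega^-1.
  by apply: powR_small; rewrite ?invr_gt0.
exists C => //; exists (Num.min (Num.min 1 h1) (E / 2 / omega)) => [|h].
  by rewrite !lt_min h10 ltr01 !divr_gt0.
rewrite !lt_min => /andP[h0 /andP[/andP[hlt1 /(conj h0)/andP/Hh1 hs] hE]].
move=> n0 near0 N nN y z z1 s sE.
have hd0 e : 0 < h `^ e by rewrite powR_gt0.
have s0 : 0 < s by rewrite sE mulr_gt0.
have s1 : s <= 1 by rewrite sE mulrC -ler_pdivlMr// div1r.
have s01 : 0 <= s <= 1 by rewrite ltW.
have sn0 : E / 2 * (h `^ delta)^-1 <= s * n0%:R.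
  by rewrite sE; apply: scaled_nearest_level_ge => //; rewrite h0.
set hk := h `^ (k%:R * (1 - delta)).
have hk0 : 0 < hk by exact: hd0.
have sk : s ^+ k = omega ^+ k * hk.
  by rewrite sE exprMn -[(h `^ _) ^+ k]powR_mulrn ?powR_ge0// -powRrM [_ * k%:R]mulrC.
have q0 : 0 < 1 + y ^+ 2 by rewrite ltr_pwDl ?sqr_ge0.
pose Ep : R := ((2 / E) ^+ 2) ^+ p.
pose b := M * (Ep * hk) / (1 + y ^+ 2).
pose F u := (D 0%N u y ^+ 2)%:C%C.
have Ep0 : 0 < Ep by rewrite !exprn_gt0// divr_gt0.
have b0 : 0 < b by rewrite divr_gt0// !mulr_gt0.
(* At the boundary [s ^+ j <= 1] is discarded, and all the smallness comes from the decay of [D]. *)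
have Fb X j : s * n0%:R <= `|X| -> (j < k)%N -> `|iter j (bdiff s) F X| <= b%:C%C.
  move=> sX jk; rewrite iter_bdiff_real_complex norm_real_complex lecR.
  apply: le_trans (HM _ _ _ _ s01 (ltnW jk)) _.
  have X0 : 0 < (1 + X ^+ 2) ^+ p by rewrite exprn_gt0// ltr_pwDl ?sqr_ge0.
  have sj : s ^+ j <= 1 by rewrite exprn_ile1 ?(ltW s0).
  apply: le_trans (ler_wpM2r _ sj) _; first by rewrite divr_ge0 ?mulr_ge0 ?ltW.
  rewrite mul1r invfM mulrA ler_pM2r ?invr_gt0// ler_pM2l//.
  have hp : (h `^ delta ^+ 2) ^+ p <= hk.
    rewrite -exprM -powR_mulrn ?powR_ge0// -powRrM ger_powR ?h0 ?(ltW hlt1)//.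
    have kd0 : 0 <= k%:R * delta by rewrite mulr_ge0// ltW.
    have pd0 : 0 <= p%:R * delta by rewrite mulr_ge0// ltW.
    by rewrite natrM; lra.
  apply: (@le_trans _ _ (Ep * (h `^ delta ^+ 2) ^+ p)); last by rewrite ler_pM2l.
  have hd := hd0 delta; have X1 : 0 < 1 + X ^+ 2 by rewrite ltr_pwDl ?sqr_ge0.
  have YX : 1 <= 2 / E * h `^ delta * `|X|.
    apply: le_trans (ler_wpM2l _ (le_trans sn0 sX)).
      by rewrite le_eqVlt; apply/orP; left; apply/eqP; field; rewrite !gt_eqF.
    by rewrite mulr_ge0 ?divr_ge0 ?ltW.
  rewrite /Ep -exprMn -exprVn -[(2 / E) ^+ 2 * _]exprMn.
  rewrite lerXn2r ?nnegrE ?invr_ge0 ?sqr_ge0 ?(ltW X1)// -div1r ler_pdivrMr//.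
  rewrite mulrDr mulr1 -[X ^+ 2]real_normK ?num_real// -exprMn.
  by rewrite -[leLHS]add0r lerD ?sqr_ge0 ?exprn_ege1.
apply: le_trans (@norm_sum_by_parts _ _ s _ F z b%:C%C N k z1 _ _ _) _.
- by rewrite lecR ltW.
- move=> j jk; apply: Fb => //.
  rewrite -opprD normrN ger0_norm ?lerDl ?(ltW s0)//.
  by rewrite addr_ge0 ?mulr_ge0 ?(ltW s0).
(* As [N >= 2 * n0 + 1], the right boundary point, one step before the end, is still at distance at
   least [s * n0] from the centre. *)
- move=> j jk; apply: Fb => //.
  have nN' : 2 * n0%:R + 1 <= N%:R :> R by rewrite -natrM natr1 ler_nat.
  have : 0 <= s * (N%:R - 2 * n0%:R - 1) by rewrite mulr_ge0 ?(ltW s0)//; lra.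
  have : 0 <= s * n0%:R by rewrite mulr_ge0 ?(ltW s0).
  by move=> ? ?; rewrite ger0_norm; lra.
under eq_bigr do rewrite iter_bdiff_real_complex norm_real_complex.
rewrite -rmorph_sum/= [X in X + _](_ : _ = (2 ^+ k * (2 * b))%:C%C); last first.
  by rewrite !(rmorphM, rmorphXn, rmorph_nat).
rewrite -rmorphD lecR.
apply: (@le_trans _ _ (2 ^+ k * (2 * b)
    + s ^+ k * (M / (1 + y ^+ 2)) * (8 / s))).
  rewrite lerD2l; apply: (@le_trans _ _ (s ^+ k * (M / (1 + y ^+ 2)) *
      \sum_(i < N) (1 + (- (s * n0%:R) + s * i%:R) ^+ 2)^-1)).
    rewrite mulr_sumr; apply: ler_sum => i _.
    apply: le_trans (HM _ _ _ _ s01 (leqnn k)) _.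
    rewrite -mulrA ler_pM2l ?exprn_gt0// -[leRHS]mulrA ler_pM2l// invfM.
    rewrite mulrC ler_pM2l ?invr_gt0//.
    set X := 1 + _; have X1 : 1 <= X by rewrite lerDl sqr_ge0.
    by rewrite lef_pV2 ?posrE ?exprn_gt0 ?(lt_le_trans ltr01)// ler_eXnr.
  by rewrite ler_wpM2l ?sum_bracket_le ?s0//
    mulr_ge0 ?exprn_ge0 ?divr_ge0 ?ltW.
rewrite sk /C -/Ep /b.
set q := (1 + y ^+ 2)^-1; set t := s^-1.
(* Since [1 / s >= 1], the boundary contribution may be multiplied by [1 / s] to match the interior
   one. *)
have t1 : 1 <= t by rewrite invf_ge1.
have {}q0 : 0 < q by rewrite invr_gt0.
have {C0}A0 : 0 <= 2 ^+ k * (2 * (M * Ep)) * hk * q.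
  by rewrite !mulr_ge0 ?exprn_ge0 ?(ltW M0) ?(ltW Ep0) ?(ltW hk0) ?(ltW q0) ?divr_ge0 ?(ltW E0).
have := ler_wpM2l A0 t1; rewrite mulr1 => At.
rewrite [leRHS](_ : _ = 2 ^+ k * (2 * (M * Ep)) * hk * q * t
    + omega ^+ k * hk * (M * q) * (8 * t)); last by ring.
by rewrite lerD2r (le_trans _ At)// le_eqVlt; apply/orP; left; apply/eqP; ring.
Qed.

End one_dimensional_estimate.

(** * Schwartz functions *)

Section schwartz.
Context {R : realType}.
Implicit Types (f : R * R -> R).

Lemma is_derive_fst f (x y : R) : differentiable f (x, y) ->
  is_derive x (1 : R) (fun u => f (u, y)) (pderiv false f (x, y)).
Proof.
move=> /diff_derivable => /(_ (1, 0)) df.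
have E : (fun h : R => h^-1 *: (((fun u => f (u, y)) \o shift x) (h *: (1 : R))
      - f (x, y)))
    = (fun h : R => h^-1 *: ((f \o shift (x, y)) (h *: (1, 0)) - f (x, y))).
  apply/funext => h /=; congr (_ *: (f _ - _)).
  by congr pair; rewrite /= scaler0 add0r.
by split; rewrite /derivable /pderiv /derive E.
Qed.

Lemma is_derive_snd f (x y : R) : differentiable f (x, y) ->
  is_derive y (1 : R) (fun v => f (x, v)) (pderiv true f (x, y)).
Proof.
move=> /diff_derivable => /(_ (0, 1)) df.
have E : (fun h : R => h^-1 *: (((fun v => f (x, v)) \o shift y) (h *: (1 : R))
      - f (x, y)))
    = (fun h : R => h^-1 *: ((f \o shift (x, y)) (h *: (0, 1)) - f (x, y))).
  apply/funext => h /=; congr (_ *: (f _ - _)).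
  by congr pair; rewrite /= scaler0 add0r.
by split; rewrite /derivable /pderiv /derive E.
Qed.

Lemma smooth2_iter f d l z : smooth2 f -> differentiable (iter l (pderiv d) f) z.
Proof.
have -> : iter l (pderiv d) f = foldr (@pderiv R) f (nseq l d).
  by elim: l => //= l ->.
exact.
Qed.

(** By [(1 + a)^p <= 2^p (1 + a^p)] for [a >= 0], the weight is dominated by four monomials, with
    exponents 0 or [2 * p] in [x] and 0 or 2 in [y]. *)
Lemma bracket_decay (g : R -> R -> R) p :
  (forall i j : nat, exists M, forall x y, `|x ^+ i * y ^+ j * g x y| <= M) ->
  exists M, forall x y,
    (1 + x ^+ 2) ^+ p * (1 + y ^+ 2) * `|g x y| <= M.
Proof.
move=> H; have [A HA] := H 0%N 0%N; have [B HB] := H (2 * p)%N 0%N.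
have [A' HA'] := H 0%N 2%N; have [B' HB'] := H (2 * p)%N 2%N.
exists (2 ^+ p * (A + B + A' + B')) => x y.
have x2 : 0 <= x ^+ 2 by exact: sqr_ge0.
have y2 : 0 <= y ^+ 2 by exact: sqr_ge0.
have wp : (1 + x ^+ 2) ^+ p <= 2 ^+ p * (1 + (x ^+ 2) ^+ p).
  have [x1|x1] := leP (x ^+ 2) 1.
    apply: (@le_trans _ _ (2 ^+ p)); first by rewrite lerXn2r ?nnegrE; lra.
    by rewrite ler_peMr ?exprn_ge0// lerDl exprn_ge0.
  apply: (@le_trans _ _ (2 ^+ p * (x ^+ 2) ^+ p)).
    by rewrite -exprMn lerXn2r ?nnegrE; lra.
  by rewrite ler_wpM2l ?exprn_ge0// lerDr.
apply: (@le_trans _ _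
    (2 ^+ p * (1 + (x ^+ 2) ^+ p) * (1 + y ^+ 2) * `|g x y|)).
  by rewrite !ler_wpM2r//; lra.
rewrite -!mulrA ler_wpM2l ?exprn_ge0//.
have := HA x y; have := HB x y; have := HA' x y; have := HB' x y.
have nE i j : `|x ^+ i * y ^+ j * g x y| = `|x| ^+ i * `|y| ^+ j * `|g x y|.
  by rewrite normrM [ `|_ ^+ i * _|]normrM !normrX.
rewrite !nE !(exprM `|x| 2 p) !real_normK ?num_real// !expr0 !mul1r !mulr1.
by move: ((x ^+ 2) ^+ p) (y ^+ 2) => a b ? ? ? ?; lra.
Qed.

Lemma schwartz2_decaying_fst f : schwartz2 f ->
  decaying_derivatives (fun l x y => iter l (pderiv false) f (x, y)).
Proof.
move=> [smf df]; split=> [l x y|l p].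
  by apply: is_derive_fst; exact: smooth2_iter.
apply: bracket_decay => i j; have [M HM] := df i j l 0%N.
by exists M => x y; exact: (HM (x, y)).
Qed.

(** The arguments are swapped so that the differentiated variable comes first. *)
Lemma schwartz2_decaying_snd f : schwartz2 f ->
  decaying_derivatives (fun l y x => iter l (pderiv true) f (x, y)).
Proof.
move=> [smf df]; split=> [l y x|l p].
  by apply: is_derive_snd; exact: smooth2_iter.
apply: bracket_decay => i j; have [M HM] := df j i 0%N l.
by exists M => y x; rewrite [y ^+ i * _]mulrC; exact: (HM (x, y)).
Qed.

(** * A box where the amplitude is bounded below, and the lattice points in it *)

Lemma positive_on_box f (z0 : R * R) : differentiable f z0 -> 0 < f z0 ->
  exists2 c, 0 < c & exists2 r, 0 < r & forall x y,
    `|x - z0.1| <= r -> `|y - z0.2| <= r -> c <= f (x, y).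
Proof.
move=> /differentiable_continuous cf f0.
have /nbhs_ballP[e /= e0 He] : \forall z \near z0, f z0 / 2 < f z.
  by apply: cvgr_gt cf _ _; lra.
exists (f z0 / 2); first by rewrite divr_gt0.
exists (e / 2) => [|x y xr yr]; first by rewrite divr_gt0.
apply/ltW/He; split; rewrite /ball/= distrC; lra.
Qed.

(** Provides at least [r / (2 s)] consecutive sample points within [r] of [x0], which bounds the
    normalizing sum from below. *)
Lemma many_levels_near (omega delta E x0 r : R) :
  0 < omega -> 0 < E -> 0 < delta < 1 -> 0 < r ->
  exists2 h0 : R, 0 < h0 &
  forall h, 0 < h < h0 ->
  forall n0, unique_nearest_level omega h E n0 ->
  forall s, s = omega * h `^ (1 - delta) ->
  exists n1 L : nat, r / 2 <= s * L%:R /\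
    forall i, (i < L)%N -> `|s * ((n1 + i)%:R - n0%:R) - x0| <= r.
Proof.
move=> omega0 E0 /andP[delta0 delta1] r0.
have [h1 h10 Hh1] : exists2 h1, 0 < h1 &
    forall h : R, 0 < h < h1 -> h `^ (1 - delta) <= r / 2 / omega.
  by apply: powR_small; rewrite ?divr_gt0// subr_gt0.
have [h2 h20 Hh2] : exists2 h2, 0 < h2 &
    forall h : R, 0 < h < h2 -> h `^ delta <= E / 2 / (`|x0| + 1).
  by apply: powR_small; rewrite ?divr_gt0// ltr_wpDl.
exists (Num.min (Num.min h1 h2) (E / 2 / omega)) => [|h].
  by rewrite !lt_min h10 h20 !divr_gt0.
rewrite !lt_min => /andP[h0 /andP[/andP[/(conj h0)/andP/Hh1 hs]]].
move=> /(conj h0)/andP/Hh2 hd hE n0 near0 s sE.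
have s0 : 0 < s by rewrite sE mulr_gt0// powR_gt0.
have sr : s <= r / 2 by rewrite sE mulrC -ler_pdivlMr.
have hd0 : 0 < h `^ delta by rewrite powR_gt0.
(* The real index [v] of [x0] is then nonnegative, so the samples just above it have indices in
   [nat]. *)
have sn0 : `|x0| <= s * n0%:R.
  apply: (@le_trans _ _ (E / 2 / h `^ delta)); last first.
    by rewrite sE; apply: scaled_nearest_level_ge => //; rewrite h0.
  move: hd; rewrite ler_pdivlMr ?ltr_wpDl// => hd.
  rewrite ler_pdivlMr// (le_trans _ hd)// mulrC ler_pM2l// lerDl.
  exact: ler01.
pose v := n0%:R + x0 / s.
have v0 : 0 <= v.
  rewrite /v -(ler_pM2l s0) mulr0 mulrDr mulrCA mulfV ?gt_eqF// mulr1.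
  by have := ler_norm (- x0); rewrite normrN; lra.
have /andP[n1 n2] := truncn_itv v0.
have rs0 : 0 <= r / s by rewrite divr_ge0 ?ltW.
have /andP[L1 L2] := truncn_itv rs0.
(* The samples start just above [v]. Truncating [r / s] loses less than one step, and [s <= r / 2]
   leaves at least [r / 2]. *)
exists (Num.truncn v).+1, (Num.truncn (r / s)); split.
  by move: L2; rewrite ltr_pdivrMr// -natr1; lra.
have {}L1 : s * (Num.truncn (r / s))%:R <= r by rewrite mulrC -ler_pdivlMr.
move=> i; rewrite -(ler_nat R) -natr1 => iL; apply: le_trans L1.
have -> : x0 = s * (v - n0%:R) by rewrite /v; field; rewrite gt_eqF.
rewrite -mulrBr normrM (gtr0_norm s0) ler_pM2l// ler_norml.
move: n2; rewrite natrD -natr1 => n2.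
by apply/andP; split; have : 0 <= i%:R :> R by []; lra.
Qed.

End schwartz.

(** * Unconditional sums *)

Section unconditional_sums.
Local Open Scope fset_scope.

Lemma partial_sum_enum {I : choiceType} {V : zmodType} (u : I -> V)
    (A : {fset I}) : summability.partial_sum u A = \sum_(x <- A) u x.
Proof. by rewrite (big_seq_fsetE _ A xpredT u). Qed.

Lemma partial_sum_fset {I : choiceType} {V : zmodType} (u : I -> V)
    (s : seq I) : uniq s ->
  summability.partial_sum u [fset x in s] = \sum_(x <- s) u x.
Proof.
move=> us; rewrite partial_sum_enum.
by apply/perm_big/uniq_perm; rewrite ?fset_uniq// => x; rewrite inE.
Qed.

Definition rectangle (n N m M : nat) : {fset nat * nat} :=
  [fset p in [seq (i, j) | i <- iota n N, j <- iota m M]].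

Lemma in_rectangle0 (n m N M : nat) :
  ((n, m) \in rectangle 0 N 0 M) = (n < N)%N && (m < M)%N.
Proof.
rewrite !inE; apply/allpairsP/andP => [[[i j]]|[nN mM]].
  by rewrite /= !mem_iota !add0n => -[/andP[_ iN] /andP[_ jM] [-> ->]].
by exists (n, m); rewrite !mem_iota.
Qed.

Lemma partial_sum_rectangle {V : zmodType} (u : nat * nat -> V) n N m M :
  summability.partial_sum u (rectangle n N m M) =
  \sum_(i < N) \sum_(j < M) u ((n + i)%N, (m + j)%N).
Proof.
have iotaE k L (F : nat -> V) :
    \sum_(i <- iota k L) F i = \sum_(i < L) F (k + i)%N.
  rewrite -[k in iota k]addn0 iotaDl big_map -[L in iota 0 L]subn0.
  by rewrite -/(index_iota 0 L) big_mkord.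
rewrite partial_sum_fset; last first.
  by apply: allpairs_uniq; rewrite ?iota_uniq// => -[? ?] [? ?] _ _.
by rewrite big_allpairs iotaE; apply: eq_bigr => i _; rewrite iotaE.
Qed.

(** Squares of arbitrarily large side are cofinal among finite index sets, so it suffices to bound
    partial sums over them. *)
Lemma fset_sub_square (A : {fset nat * nat}) (N0 : nat) :
  exists2 N, (N0 <= N)%N & A `<=` rectangle 0 N 0 N.
Proof.
exists (maxn N0 (\max_(p <- A) maxn p.1 p.2).+1); first exact: leq_maxl.
apply/fsubsetP => -[n m] nmA; rewrite in_rectangle0.
have : (maxn n m <= \max_(p <- A) maxn p.1 p.2)%N.
  by apply: (@leq_bigmax_seq _ _ _ (fun p => maxn p.1 p.2) (n, m)).
rewrite geq_max => /andP[nA mA].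
by apply/andP; split; rewrite leq_max ltnS ?nA ?mA orbT.
Qed.

(* Divergent families need no separate treatment: their sum is 0 by convention. *)
Lemma norm_sum_le {I : choiceType} {K : numFieldType} (u : I -> K^o) (B : K) :
  0 <= B ->
  (forall A : {fset I}, exists2 A' : {fset I},
     A `<=` A' & `|summability.partial_sum u A'| <= B) ->
  `|summability.sum u| <= B.
Proof.
move=> B0 uB; rewrite /summability.sum.
have [cvu|dvu] := pselect (cvg (summability.partial_sum u @ summability.totally)%classic);
  last by rewrite (dvgP dvu) normr0.
set l := lim _.
rewrite real_leNgt ?ger0_real ?normr_ge0//; apply/negP => lB.
have e0 : 0 < `|l| - B by rewrite subr_gt0.
have FF := @summability.totally_filter I.
have /cvgrPdist_lt /(_ _ e0) [A _ HA] := cvu.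
have [A' AA' uA'] := uB A.
have := ltr_leD (HA A' AA') uA'; rewrite /= subrK.
have := ler_normD (l - summability.partial_sum u A') (summability.partial_sum u A').
by rewrite subrK => /le_lt_trans H /H; rewrite ltxx.
Qed.

(** The first alternative covers families that are not summable, whose sum takes the default value
    0. *)
Lemma partial_sum_le_sum {I : choiceType} {R : realType} (u : I -> R^o)
    (A : {fset I}) : (forall i, 0 <= u i) ->
  summability.sum u = 0 \/ summability.partial_sum u A <= summability.sum u.
Proof.
move=> u0; rewrite /summability.sum.
have [cvu|dvu] :=
    pselect (cvg (summability.partial_sum u @ summability.totally)%classic);
  last by left; rewrite (dvgP dvu).
right; set l := lim _.
rewrite leNgt; apply/negP => lA.
have e0 : 0 < summability.partial_sum u A - l by rewrite subr_gt0.
have FF := @summability.totally_filter I.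
have /cvgrPdist_lt /(_ _ e0) [B _ HB] := cvu.
(* An enumeration of the union of [A] and [B] with [A] first: its sum is that over [A] plus a
   nonnegative rest, yet must be close to the limit. *)
pose s : seq I := enum_fset A ++ [seq x <- B | x \notin A].
have us : uniq s.
  rewrite cat_uniq filter_uniq ?fset_uniq// andbT /=.
  by apply/hasPn => x; rewrite mem_filter => /andP[].
have Bs : B `<=` [fset x in s].
  apply/fsubsetP => x xB; rewrite in_fset.
  by change (x \in s); rewrite mem_cat mem_filter xB andbT; exact: orbN.
have := HB _ Bs; rewrite /= partial_sum_fset// big_cat /= -partial_sum_enum.
rewrite ltr_norml => /andP[+ _].
have : 0 <= \sum_(x <- [seq x <- B | x \notin A]) u x by exact: sumr_ge0.
rewrite -/l => ? ?; lra.
Qed.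

End unconditional_sums.

(** * Distance to the lattice *)

Section lattice_distance.
Context {R : realType}.
Implicit Types (x y r : R).

Lemma expiD x y : expi (x + y) = expi x * expi y.
Proof. by rewrite /expi cosD sinD [sin x * cos y + _]addrC. Qed.

Lemma expiMn x n : expi (x * n%:R) = expi x ^+ n.
Proof.
elim: n => [|n IH]; first by rewrite mulr0 /expi cos0 sin0.
by rewrite -natr1 mulrDr mulr1 expiD IH exprSr.
Qed.

Lemma norm_expi x : `|expi x| = 1.
Proof. by rewrite normc_def /= cos2Dsin2 sqrtr1. Qed.

Lemma nearest_int x : exists2 p : int, `|x - p%:~R| <= 2^-1 &
  forall q : int, `|x - p%:~R| <= `|x - q%:~R|.
Proof.
exists (Num.floor (x + 2^-1)).
  have := floor_itv (x + 2^-1); rewrite intrD => /andP[? ?].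
  by rewrite ler_norml; apply/andP; split; lra.
have := floor_itv (x + 2^-1); set p := Num.floor _ => /andP[p1 p2] q.
have px : `|x - p%:~R| <= 2^-1.
  by move: p2; rewrite intrD ler_norml => p2; apply/andP; split; lra.
have [<-//|pq] := eqVneq p q; apply: le_trans px _; rewrite ler_normr.
move: pq; rewrite neq_lt -!lezD1 -!(ler_int R) !intrD => /orP[pq|qp].
  by apply/orP; right; lra.
by apply/orP; left; lra.
Qed.

Lemma cos_2pi_int x (p : int) : cos (2 * pi * (x + p%:~R)) = cos (2 * pi * x) :> R.
Proof.
have cosn y (n : nat) : cos (2 * pi * (y + n%:R)) = cos (2 * pi * y) :> R.
  rewrite mulrDr (_ : 2 * pi * n%:R = (pi *+ 2) *+ n) ?(periodicn (@cosD2pi R))//.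
  by rewrite -[RHS]mulr_natr -[pi *+ 2]mulr_natl.
case: p => n; first by rewrite -pmulrn cosn.
by rewrite NegzE mulrNz -(cosn (x + - _) n.+1) -pmulrn subrK.
Qed.

(** The modulus is at least the real part [1 - cos (2 pi x)]. Reduced to the nearest integer, [|x|]
    lies in [[r, 1/2]], where the cosine of [2 pi |x|] decreases. If [r > 1/2], no [x] qualifies. *)
Lemma norm_1_sub_expi_ge r : 0 < r -> exists2 c, 0 < c & forall x,
  (forall p : int, r <= `|x - p%:~R|) -> c%:C%C <= `|1 - expi (- (2 * pi * x))|.
Proof.
move=> r0; have [r1|r1] := ltP 2^-1 r.
  exists 1 => // x rx; have [p xp _] := nearest_int x.
  by have := lt_le_trans r1 (le_trans (rx p) xp); rewrite ltxx.
have pi0 := pi_gt0 R.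
have itv_pi u : 0 <= u <= 2^-1 -> 2 * pi * u \in `[0, (pi : R)].
  move=> /andP[u0 u1]; rewrite in_itv /= !mulr_ge0 ?(ltW pi0)//=.
  have : 0 <= pi * (2^-1 - u) by rewrite mulr_ge0 ?(ltW pi0) ?subr_ge0.
  by lra.
exists (1 - cos (2 * pi * r)).
  have rI : 2 * pi * r \in `[0, (pi : R)] by rewrite itv_pi ?(ltW r0).
  have zI : 0 \in `[0, (pi : R)] by rewrite in_itv /= lexx ltW.
  by rewrite subr_gt0 -[ltRHS]cos0 ltr_cos// !mulr_gt0.
move=> x rx; rewrite normc_def lecR /= cosN.
apply: (@le_trans _ _ `|1 - cos (2 * pi * x)|); last first.
  by rewrite -sqrtr_sqr ler_wsqrtr// lerDl sqr_ge0.
apply: le_trans (ler_norm _); rewrite lerD2l lerN2.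
have [p xp _] := nearest_int x.
rewrite -[x](subrK p%:~R) cos_2pi_int; set d := x - p%:~R in xp *.
have -> : cos (2 * pi * d) = cos (2 * pi * `|d|).
  have [d0|d0] := leP 0 d; first by rewrite ger0_norm.
  by rewrite ltr0_norm// mulrN cosN.
have rd := rx p; rewrite -/d in rd.
rewrite leNgt ltr_cos ?itv_pi ?normr_ge0//; last by rewrite (ltW r0).
by rewrite -leNgt ler_pM2l// mulr_gt0.
Qed.

(** If both coordinates were closer than [r / 2] to integers, the lattice point they define would be
    closer than [r]. It is not the origin because [x >= 1] has a nonzero nearest integer. *)
Lemma dist_lattice_coordinate x y r : 1 <= x -> 1 <= y -> 0 < r ->
  r <= dist_lattice x y ->
  (forall p : int, r / 2 <= `|x - p%:~R|) \/
  (forall q : int, r / 2 <= `|y - q%:~R|).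
Proof.
move=> x1 y1 r0 rd.
have [p xp pmin] := nearest_int x; have [q yq qmin] := nearest_int y.
have [px|px] := leP (r / 2) `|x - p%:~R|.
  by left => n; exact: le_trans px (pmin n).
have [qy|qy] := leP (r / 2) `|y - q%:~R|.
  by right => n; exact: le_trans qy (qmin n).
exfalso.
have p0 : p != 0.
  by apply/eqP => p0; move: xp; rewrite p0 subr0 ger0_norm; lra.
have : dist_lattice x y <= Num.sqrt ((x - p%:~R) ^+ 2 + (y - q%:~R) ^+ 2).
  apply: ge_inf; first by exists 0 => _ [? _ <-]; exact: sqrtr_ge0.
  by exists (p, q) => //=; rewrite xpair_eqE negb_and p0.
apply/negP; rewrite -ltNge (lt_le_trans _ rd)//.
rewrite -[ltRHS]ger0_norm ?(ltW r0)// -sqrtr_sqr ltr_sqrt ?exprn_gt0//.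
have sq u : `|u| < r / 2 -> u ^+ 2 < (r / 2) ^+ 2.
  by move=> ur; rewrite -real_normK ?num_real// ltrXn2r ?nnegrE// divr_ge0 ?ltW.
by have := sq _ px; have := sq _ qy; have := exprn_gt0 2 r0; lra.
Qed.

(** The right side decreases in [t], and [t_eta] is where it equals [eta]. *)
Lemma le_t_eta (a b K eta eps t : R) : 0 < a -> 0 < eta -> 0 < eps -> 0 < K ->
  0 <= t -> t <= t_eta a b K eta eps ->
  eta <= K * (Num.sqrt 2 / 2 + t * Num.sqrt (a ^+ 2 + b ^+ 2)) `^ (- (1 + eps)).
Proof.
move=> a0 eta0 eps0 K0 t0; rewrite /t_eta.
set c := Num.sqrt (_ + _); set q := Num.sqrt 2 / 2.
have c0 : 0 < c by rewrite sqrtr_gt0 ltr_pwDl ?sqr_ge0 ?exprn_gt0.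
have q0 : 0 < q by rewrite divr_gt0// sqrtr_gt0.
rewrite mulrC ler_pdivlMr// => tc.
have v0 : 0 < q + t * c by rewrite ltr_pwDl// mulr_ge0 ?(ltW c0).
have e0 : 0 < 1 + eps by lra.
have {tc} : q + t * c <= (K / eta) `^ (1 + eps)^-1 by lra.
have KN : (K / eta) `^ (1 + eps)^-1 \is Num.nneg by rewrite nnegrE powR_ge0.
have vN : q + t * c \is Num.nneg by rewrite nnegrE ltW.
move=> /(ge0_ler_powR (ltW e0) vN KN).
rewrite -powRrM mulVf ?gt_eqF// powRr1 ?divr_ge0 ?(ltW K0) ?(ltW eta0)//.
by move=> H; rewrite powRN ler_pdivlMr ?powR_gt0// mulrC -ler_pdivlMr.
Qed.

End lattice_distance.

(** * The normalized double sum *)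

Lemma double_oscillating_sum_le {R : realType} (D : nat -> R -> R -> R)
    (k : nat) (omega delta E : R) :
  decaying_derivatives D -> 0 < omega -> 0 < E -> 0 < delta < 1 ->
  exists2 C : R, 0 < C & exists2 h0 : R, 0 < h0 &
  forall h, 0 < h < h0 ->
  forall n0, unique_nearest_level omega h E n0 ->
  forall N, (2 * n0 < N)%N ->
  forall s, s = omega * h `^ (1 - delta) ->
  forall s' : R, 0 < s' <= 1 ->
  forall (m0 : nat) (z w : R[i]), `|z| = 1 -> `|w| = 1 ->
  `|1 - z| ^+ k *
  `|\sum_(i < N) \sum_(j < N)
      (D 0%N (s * (i%:R - n0%:R)) (s' * (j%:R - m0%:R)) ^+ 2)%:C%C
      * (z ^+ i * w ^+ j)|
  <= (C * h `^ (k%:R * (1 - delta)) / (s * s'))%:C%C.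
Proof.
move=> Ddec omega0 E0 delta01.
have [C C0 [h0 h00 HC]] := oscillating_sum_le D k omega delta E Ddec omega0 E0 delta01.
exists (8 * C); first by rewrite mulr_gt0.
exists h0 => // h hh n0 near0 N nN s sE s' s'01 m0 z w z1 w1.
have s0 : 0 < s by rewrite sE mulr_gt0// powR_gt0; case/andP: hh.
have s'0 : 0 < s' by case/andP: s'01.
set hk := h `^ _.
have hk0 : 0 <= hk by exact: powR_ge0.
(* The inner sum must run over the oscillating index [i]; for fixed [j] the factor [w ^+ j] has
   modulus 1. *)
rewrite exchange_big /=.
apply: (@le_trans _ _ (\sum_(j < N)
    (C * hk / s / (1 + (- (s' * m0%:R) + s' * j%:R) ^+ 2))%:C%C)).
  apply: le_trans (ler_wpM2l _ (ler_norm_sum _ _ _)) _; first by rewrite exprn_ge0.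
  rewrite mulr_sumr; apply: ler_sum => j _.
  rewrite (_ : \sum_(i < N) _ = w ^+ j * \sum_(i < N)
      (D 0%N (- (s * n0%:R) + s * i%:R) (- (s' * m0%:R) + s' * j%:R) ^+ 2)%:C%C
      * z ^+ i); last first.
    rewrite mulr_sumr; apply: eq_bigr => i _.
    rewrite (_ : s * (i%:R - _) = - (s * n0%:R) + s * i%:R); last by ring.
    rewrite (_ : s' * (j%:R - _) = - (s' * m0%:R) + s' * j%:R); last by ring.
    by rewrite [z ^+ i * _]mulrC mulrCA.
  by rewrite normrM normrX w1 expr1n mul1r; apply: HC.
rewrite -rmorph_sum lecR /= -mulr_sumr.
rewrite (_ : 8 * C * hk / (s * s') = C * hk / s * (8 / s')); last first.
  by field; rewrite !gt_eqF.
by rewrite ler_wpM2l ?sum_bracket_le// divr_ge0 ?mulr_ge0 ?(ltW C0) ?(ltW s0).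
Qed.

Lemma unnormalized_coefE {R : realType} (omega1 omega2 delta1 delta2 : R)
    chi (h : R) (n0 m0 n m : nat) : 0 < h ->
  unnormalized_coef omega1 omega2 delta1 delta2 chi h n0 m0 n%:Z m%:Z =
  chi (omega1 * h `^ (1 - delta1) * (n%:R - n0%:R),
       omega2 * h `^ (1 - delta2) * (m%:R - m0%:R)).
Proof.
move=> h0; have E omega delta (i j : nat) :
    (level omega h i%:Z - level omega h j%:Z) / h `^ delta =
    omega * h `^ (1 - delta) * (i%:R - j%:R).
  rewrite /level -!pmulrn powRB ?(gt_eqF h0) ?implybT// powRr1 ?(ltW h0)//.
  by field; rewrite gt_eqF// powR_gt0.
by rewrite /unnormalized_coef !E.
Qed.

(** The squared norm is at least [c^2] times the number of lattice points in a box where [chi >= c],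
    and that number is at least [(r / 2)^2 / (s1 s2)]. *)
Lemma normalization_le {R : realType} (omega1 omega2 E1 E2 delta1 delta2 : R)
    (chi : R * R -> R) :
  0 < omega1 -> 0 < omega2 -> 0 < E1 -> 0 < E2 ->
  0 < delta1 < 1 -> 0 < delta2 < 1 ->
  (exists2 z, differentiable chi z & 0 < chi z) ->
  exists2 C : R, 0 < C & exists2 h0 : R, 0 < h0 &
  forall h, 0 < h < h0 -> forall n0 m0,
  unique_nearest_level omega1 h E1 n0 ->
  unique_nearest_level omega2 h E2 m0 ->
  (l2norm (fun p : nat * nat =>
     unnormalized_coef omega1 omega2 delta1 delta2 chi h n0 m0 p.1%:Z p.2%:Z))
    ^-1 ^+ 2
  <= C * ((omega1 * h `^ (1 - delta1)) * (omega2 * h `^ (1 - delta2))).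
Proof.
move=> omega10 omega20 E10 E20 delta101 delta201 [z0 dchi chi0].
have [c c0 [r r0 Hc]] := positive_on_box chi z0 dchi chi0.
have [h1 h10 H1] := many_levels_near omega1 delta1 E1 z0.1 r omega10 E10 delta101 r0.
have [h2 h20 H2] := many_levels_near omega2 delta2 E2 z0.2 r omega20 E20 delta201 r0.
pose C := ((c * (r / 2)) ^+ 2)^-1.
have cr0 : 0 < c * (r / 2) by rewrite mulr_gt0// divr_gt0.
have C0 : 0 < C by rewrite invr_gt0 exprn_gt0.
exists C => //; exists (Num.min h1 h2) => [|h]; first by rewrite lt_min h10.
rewrite lt_min => /andP[h0 /andP[/(conj h0)/andP hh1 /(conj h0)/andP hh2]].
move=> n0 m0 nearn nearm.
have [n1 [L1 [sL1 HL1]]] := H1 h hh1 n0 nearn _ erefl.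
have [m1 [L2 [sL2 HL2]]] := H2 h hh2 m0 nearm _ erefl.
set s1 := omega1 * _ in sL1 HL1 *; set s2 := omega2 * _ in sL2 HL2 *.
have s10 : 0 < s1 by rewrite mulr_gt0// powR_gt0.
have s20 : 0 < s2 by rewrite mulr_gt0// powR_gt0.
set u := (fun p : nat * nat => _); rewrite /l2norm.
have [->|uS] := @partial_sum_le_sum _ R (fun p => `|u p| ^+ 2 : R^o)
    (rectangle n1 L1 m1 L2) (fun p => sqr_ge0 _).
  (* If the sum is 0, the inverse norm is 0 by convention and the bound is immediate. *)
  rewrite sqrtr0 invr0 expr0n /=; exact: ltW (mulr_gt0 C0 (mulr_gt0 s10 s20)).
set S := summability.sum _ in uS *.
have LS : L1%:R * (L2%:R * c ^+ 2) <= S.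
  apply: le_trans uS; rewrite partial_sum_rectangle.
  rewrite -[L1 in L1%:R]card_ord mulr_natl -sumr_const ler_sum// => i _.
  rewrite -[L2 in L2%:R]card_ord mulr_natl -sumr_const ler_sum// => j _.
  have cu : c <= u ((n1 + i)%N, (m1 + j)%N).
    by rewrite /u unnormalized_coefE// Hc ?HL1 ?HL2.
  rewrite lerXn2r ?nnegrE ?(ltW c0)//.
  exact: le_trans cu (ler_norm _).
have rL : r / 2 * (r / 2) <= s1 * L1%:R * (s2 * L2%:R).
  by rewrite ler_pM// divr_ge0 ?(ltW r0).
have c20 : 0 < c ^+ 2 by rewrite exprn_gt0.
have CS : (c * (r / 2)) ^+ 2 <= s1 * s2 * S.
  apply: (@le_trans _ _ (s1 * s2 * (L1%:R * (L2%:R * c ^+ 2)))).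
    rewrite [leRHS](_ : _ = c ^+ 2 * (s1 * L1%:R * (s2 * L2%:R))); last by ring.
    by rewrite exprMn ler_pM2l.
  by rewrite ler_pM2l// mulr_gt0.
have S0 : 0 < S.
  by rewrite -(pmulr_rgt0 _ (mulr_gt0 s10 s20)) (lt_le_trans _ CS)// exprn_gt0.
rewrite exprVn sqr_sqrtr ?(ltW S0)// -div1r ler_pdivrMr// -mulrA /C.
by rewrite ler_pdivlMl ?exprn_gt0// mulr1.
Qed.

(** * Assembly of the bound on the autocorrelation *)

Lemma dist_int_Tcl {R : realType} (T t r : R) : T != 0 ->
  (forall p : int, r <= `|1 / `|T| * t - p%:~R|) ->
  forall p : int, r <= `|t / T - p%:~R|.
Proof.
move=> T0 H p; have [T1|T1] := leP 0 T.
  by have := H p; rewrite (ger0_norm T1) div1r mulrC.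
have := H (- p); rewrite (ltr0_norm T1) div1r invrN mulNr mulrC mulrNz opprK.
by rewrite -normrN opprD opprK.
Qed.

Lemma norm_le_of_geometric {R : realType} (c V Q : R) (e z S : R[i]) (k : nat) :
  0 < c -> c%:C%C <= `|1 - z| -> `|e| = 1 -> 0 <= Q ->
  `|1 - z| ^+ k * `|S| <= V%:C%C ->
  `|Q%:C%C * e * S| <= (Q * (V / c ^+ k))%:C%C.
Proof.
move=> c0 cz e1 Q0 zS.
have ck0 : 0 < c ^+ k by rewrite exprn_gt0.
have cS : (c ^+ k)%:C%C * `|S| <= V%:C%C.
  apply: le_trans zS; rewrite ler_wpM2r// (rmorphXn (real_complex R)).
  by rewrite lerXn2r ?nnegrE ?normr_ge0 ?ler0c ?(ltW c0).
rewrite 2!normrM e1 mulr1 norm_real_complex (ger0_norm Q0).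
rewrite (rmorphM (real_complex R)) ler_wpM2l ?ler0c//.
rewrite mulrC (rmorphM (real_complex R)).
rewrite -[leLHS]mul1r -[1](rmorph1 (real_complex R)) -(mulVf (lt0r_neq0 ck0)).
by rewrite (rmorphM (real_complex R)) -mulrA ler_wpM2l// ler0c invr_ge0 ltW.
Qed.

Lemma Tcl_neq0 {R : realType} (omega dF : R) :
  0 < omega -> dF != 0 -> Tcl omega dF != 0.
Proof.
move=> omega0 dF0; have pi2 : 2 * pi != 0 :> R.
  by rewrite gt_eqF// mulr_gt0 ?pi_gt0.
by rewrite mulf_neq0// invr_eq0 mulf_neq0// gt_eqF.
Qed.

Theorem theorem3p24 (R : realType) (omega1 omega2 : R)
    (F : {poly {poly R}}) (E1 E2 delta1 delta2 : R) (chi : R * R -> R)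
    (omega1_gt0 : 0 < omega1) (omega2_gt0 : 0 < omega2)
    (E1_bnd : 0 < E1 <= 1) (E2_bnd : 0 < E2 <= 1)
    (delta1_bnd : 0 < delta1 < 1) (delta2_bnd : 0 < delta2 < 1)
    (chi_schwartz : schwartz2 chi) (chi_ge0 : forall z : R * R, 0 <= chi z)
    (chi_neq0 : exists z : R * R, chi z != 0)
    (dXF_neq0 : (dX F).[E1, E2] != 0) (dYF_neq0 : (dY F).[E1, E2] != 0) :
  let T1 := Tcl omega1 (dX F).[E1, E2] in
  let T2 := Tcl omega2 (dY F).[E1, E2] in
  let a := 1 / `|T1| in
  let b := 1 / `|T2| in
  let theta := b / a in
  forall (theta_roth : roth_number theta)
    (C K : R -> R)
    (C_roth : forall eps : R, 0 < eps -> roth_constant theta eps (C eps))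
    (K_bnd : forall eps : R, 0 < eps -> 0 < K eps <= C eps)
    (K_dist : forall eps t : R, 0 < eps -> 0 <= t ->
       K eps * (Num.sqrt 2 / 2 + t * Num.sqrt (a ^+ 2 + b ^+ 2))
                 `^ (- (1 + eps))
       <= dist_lattice (a * t) (b * t)),
  forall eps : R, 0 < eps ->
  forall eta : R, 0 < eta < Num.sqrt 2 `^ (1 + eps) / 2 ->
    Num.max `|T1| `|T2| <= t_eta a b (K eps) eta eps ->
  forall k : nat, (1 <= k)%N ->
  exists2 D : R, 0 < D &
  exists2 h0 : R, 0 < h0 &
    forall h : R, 0 < h < h0 ->
    forall n0 m0 : nat,
      unique_nearest_level omega1 h E1 n0 ->
      unique_nearest_level omega2 h E2 m0 ->
    forall t : R,
      Num.max `|T1| `|T2| <= t <= t_eta a b (K eps) eta eps ->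
      `| autocorr1 omega1 omega2 delta1 delta2 chi T1 T2 h n0 m0 t |
      <= (D * h `^ (k%:R * (1 - Num.max delta1 delta2)) * eta ^- k)%:C%C.
Proof.
move=> T1 T2 a b theta theta_roth C K C_roth K_bnd K_dist eps eps0 eta.
move=> /andP[eta0 eta_lt] t_range k k1.
have T10 : T1 != 0 by exact: Tcl_neq0.
have T20 : T2 != 0 by exact: Tcl_neq0.
have [/andP[E10 _] /andP[E20 _]] := (E1_bnd, E2_bnd).
have [/andP[_ d11] /andP[_ d21]] := (delta1_bnd, delta2_bnd).
have eta20 : 0 < eta / 2 by rewrite divr_gt0.
(* [c] depends on [eta] only, hence is uniform in [t] and [h]. *)
have [c c0 Hc] := norm_1_sub_expi_ge (eta / 2) eta20.
have [smooth_chi _] := chi_schwartz.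
have [CQ CQ0 [hQ hQ0 HQ]] : exists2 C : R, 0 < C & exists2 h0 : R, 0 < h0 &
  forall h, 0 < h < h0 -> forall n0 m0,
  unique_nearest_level omega1 h E1 n0 ->
  unique_nearest_level omega2 h E2 m0 ->
  (l2norm (fun p : nat * nat =>
     unnormalized_coef omega1 omega2 delta1 delta2 chi h n0 m0 p.1%:Z p.2%:Z))
    ^-1 ^+ 2
  <= C * ((omega1 * h `^ (1 - delta1)) * (omega2 * h `^ (1 - delta2))).
  apply: (normalization_le _ _ E1 E2) => //.
  have [z chiz] := chi_neq0; exists z; first exact: (smooth_chi [::]).
  by rewrite lt_neqAle eq_sym chiz chi_ge0.
have [C1 C10 [h1 h10 H1]] := double_oscillating_sum_le _ k omega1 delta1 E1
  (schwartz2_decaying_fst _ chi_schwartz) omega1_gt0 E10 delta1_bnd.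
have [C2 C20 [h2 h20 H2]] := double_oscillating_sum_le _ k omega2 delta2 E2
  (schwartz2_decaying_snd _ chi_schwartz) omega2_gt0 E20 delta2_bnd.
have small_step omega delta : 0 < omega -> delta < 1 -> exists2 h0 : R, 0 < h0 &
    forall h, 0 < h < h0 -> 0 < omega * h `^ (1 - delta) <= 1.
  move=> omega0 d1; have d0 : 0 < 1 - delta by rewrite subr_gt0.
  have omegaV0 : 0 < omega^-1 by rewrite invr_gt0.
  have [h0 h00 Hh0] := powR_small _ _ d0 omegaV0.
  exists h0 => // h hh; have /andP[h_gt0 _] := hh.
  by rewrite mulr_gt0 ?powR_gt0//= mulrC -ler_pdivlMr// div1r Hh0.
have [h3 h30 H3] := small_step _ _ omega1_gt0 d11.
have [h4 h40 H4] := small_step _ _ omega2_gt0 d21.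
(* [C1 + C2] covers both directions, since the usable one varies with [t]. *)
pose B := CQ * (C1 + C2) / c ^+ k.
have B0 : 0 < B by rewrite divr_gt0 ?exprn_gt0// mulr_gt0// addr_gt0.
(* [eta ^+ k] cancels the [eta ^- k] of the claim. *)
exists (B * eta ^+ k); first by rewrite mulr_gt0 ?exprn_gt0.
(* The unit 1 forces [h < 1], so the larger of the two exponents [delta] gives the weaker power of
   [h]. *)
pose h0 := \big[Num.min/1]_(x <- [:: hQ; h1; h2; h3; h4]) x.
exists h0; first by rewrite /h0 !big_cons big_nil !lt_min; do ?[apply/andP; split].
move=> h /andP[h_gt0]; rewrite /h0 !big_cons big_nil !lt_min.
move=> /andP[/(conj h_gt0)/andP/HQ{}HQ] /andP[/(conj h_gt0)/andP/H1{}H1].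
move=> /andP[/(conj h_gt0)/andP/H2{}H2] /andP[/(conj h_gt0)/andP/H3 s1].
move=> /andP[/(conj h_gt0)/andP/H4 s2 h_lt1] n0 m0 nearn nearm t.
rewrite ge_max => /andP[/andP[tT1 tT2] t_le].
have /andP[s10 _] := s1; have /andP[s20 _] := s2.
set hk := h `^ _; have hk0 : 0 < hk by rewrite powR_gt0.
have hkE delta : 0 < delta < 1 -> delta <= Num.max delta1 delta2 ->
    h `^ (k%:R * (1 - delta)) <= hk.
  move=> _ dmax; rewrite ger_powR ?h_gt0 ?(ltW h_lt1)// ler_wpM2l//.
  by rewrite lerD2l lerN2.
rewrite mulrAC mulfK ?expf_neq0 ?gt_eqF//.
(* The lower limit on [t] puts both coordinates of [phi_t] at 1 or more, away from the excluded
   origin. *)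
have at1 (T : R) : T != 0 -> `|T| <= t -> 1 <= 1 / `|T| * t.
  by move=> T0 Tt; rewrite div1r ler_pdivlMl ?normr_gt0// mulr1.
have t0 : 0 <= t by exact: le_trans tT1.
have a0 : 0 < a by rewrite divr_gt0 ?normr_gt0.
have /andP[Keps0 _] := K_bnd _ eps0.
have eta_le : eta <= dist_lattice (a * t) (b * t).
  apply: le_trans (K_dist _ _ eps0 t0).
  exact: le_t_eta.
pose z := expi (- (2 * pi * (t / T1))); pose w := expi (- (2 * pi * (t / T2))).
(* [e] collects the phase due to centring at [(n0, m0)], leaving pure powers of [z] and [w]. *)
pose e := expi (2 * pi * t * (n0%:R / T1 + m0%:R / T2)).
set s_1 := omega1 * _ in s1 s10 H1 HQ *; set s_2 := omega2 * _ in s2 s20 H2 HQ *.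
have s120 : 0 < s_1 * s_2 by exact: mulr_gt0.
have {}HQ := HQ _ _ nearn nearm.
set Q := _^-1 ^+ 2 in HQ.
have Q0 : 0 <= Q by exact: sqr_ge0.
have psE N : summability.partial_sum (fun p : nat * nat =>
    (`| coef omega1 omega2 delta1 delta2 chi h n0 m0 p.1%:Z p.2%:Z | ^+ 2)%:C%C
    * expi (- (2 * pi * t * ((p.1%:R - n0%:R) / T1 + (p.2%:R - m0%:R) / T2))))
    (rectangle 0 N 0 N) = Q%:C%C * e *
    \sum_(i < N) \sum_(j < N)
      (chi (s_1 * (i%:R - n0%:R), s_2 * (j%:R - m0%:R)) ^+ 2)%:C%C
      * (z ^+ i * w ^+ j).
  rewrite partial_sum_rectangle mulr_sumr; apply: eq_bigr => i _.
  rewrite mulr_sumr; apply: eq_bigr => j _.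
  rewrite !add0n /coef real_normK ?num_real// exprMn -/Q unnormalized_coefE//.
  rewrite /= -/s_1 -/s_2 (rmorphM (real_complex R)).
  rewrite /z /w -!expiMn (_ : - _ = 2 * pi * t * (n0%:R / T1 + m0%:R / T2)
    + (- (2 * pi * (t / T1)) * i%:R + - (2 * pi * (t / T2)) * j%:R)); last first.
    by field; rewrite T10 T20.
  by rewrite !expiD -/e; ring.
have bound Cd delta z' S : 0 < Cd <= C1 + C2 -> 0 < delta < 1 ->
    delta <= Num.max delta1 delta2 -> c%:C%C <= `|1 - z'| ->
    `|1 - z'| ^+ k * `|S| <= (Cd * h `^ (k%:R * (1 - delta)) / (s_1 * s_2))%:C%C ->
    `|Q%:C%C * e * S| <= (B * hk)%:C%C.
  move=> /andP[Cd0 CdC] d01 dmax cz' zS.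
  apply: le_trans (norm_le_of_geometric _ _ _ _ _ _ _ c0 cz' (norm_expi _) Q0 zS) _.
  rewrite lecR.
  apply: (@le_trans _ _ (CQ * (s_1 * s_2) *
    ((C1 + C2) * hk / (s_1 * s_2) / c ^+ k))).
    rewrite ler_pM//.
      by rewrite !divr_ge0 ?exprn_ge0 ?mulr_ge0 ?powR_ge0 ?ltW.
    rewrite ler_pM2r ?invr_gt0 ?exprn_gt0// ler_pM2r ?invr_gt0//.
    by rewrite ler_pM ?powR_ge0 ?hkE ?(ltW Cd0).
  rewrite le_eqVlt; apply/orP; left; apply/eqP; rewrite /B.
  by field; rewrite !gt_eqF ?exprn_gt0.
have sum_le N : (2 * n0 < N)%N -> (2 * m0 < N)%N ->
    `|Q%:C%C * e * \sum_(i < N) \sum_(j < N)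
      (chi (s_1 * (i%:R - n0%:R), s_2 * (j%:R - m0%:R)) ^+ 2)%:C%C
      * (z ^+ i * w ^+ j)| <= (B * hk)%:C%C.
  move=> nN mN.
  have [|] := dist_lattice_coordinate _ _ _ (at1 _ T10 tT1) (at1 _ T20 tT2) eta0 eta_le.
    move=> /(dist_int_Tcl _ _ _ T10)/Hc cz.
    apply: (bound C1 delta1 z) => //; first by rewrite C10 lerDl ltW.
      by rewrite le_max lexx.
    apply: H1 => //; exact: norm_expi.
  move=> /(dist_int_Tcl _ _ _ T20)/Hc cw.
  apply: (bound C2 delta2 w) => //; first by rewrite C20 lerDr ltW.
    by rewrite le_max lexx orbT.
  (* The two indices exchange roles so that the sum in [m] carries the oscillation. *)
  rewrite exchange_big /= [s_1 * s_2]mulrC.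
  under eq_bigr do under eq_bigr do rewrite [z ^+ _ * _]mulrC.
  apply: H2 => //; exact: norm_expi.
apply: norm_sum_le; first by rewrite ler0c mulr_ge0 ?ltW.
move=> A; have [N] := fset_sub_square A (maxn (2 * n0) (2 * m0)).+1.
rewrite gtn_max => /andP[nN mN] AN; exists (rectangle 0 N 0 N) => //.
by rewrite psE; exact: sum_le.
Qed.
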